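(* For every positive integer $k$, $\mathrm{mader}_{\delta^+}^{(4k+2)}(C(k,k))=2$. Equivalently: every digraph $D$ with minimum out-degree $\delta^+(D)\geq 2$ and girth $g(D)\geq 4k+2$ contains a subdivision of $C(k,k)$ as a subdigraph, and $2$ is the least integer with this property.
   Context: Digraphs are finite, with no loops and no parallel arcs. $\delta^+(D)$ denotes the minimum out-degree of $D$. A (directed) path/cycle is one in which all arcs are oriented consistently. The girth $g(D)$ is the length of a shortest directed cycle of $D$, with $g(D)=+\infty$ if $D$ has no directed cycle. For positive integers $k,\ell$, $C(k,\ell)$ denotes the digraph formed by two internally vertex-disjoint directed paths of lengths $k$ and $\ell$ having the same initial vertex and the same terminal vertex. For a digraph $F$, a subdivision of $F$ is a digraph obtained from $F$ by replacing each arc $xy$ by a directed path from $x$ to $y$, these paths being pairwise internally vertex-disjoint. For an integer $g$ and a digraph $F$, $\mathrm{mader}_{\delta^+}^{(g)}(F)$ denotes the least integer $m$ such that every digraph $D$ with $\delta^+(D)\geq m$ and $g(D)\geq g$ contains a subdivision of $F$ as a subdigraph. *)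

(* Defs.v *)
From mathcomp Require Import all_boot.

Set Implicit Arguments.
Unset Strict Implicit.
Unset Printing Implicit Defensive.

(* Opposite arcs (directed 2-cycles) are allowed. *)
Record digraph := Digraph {
  vertex :> finType;
  arc : rel vertex;
  arc_irrefl : irreflexive arc
}.

Definition outdeg (D : digraph) (v : D) : nat := #|[set w | arc v w]|.

(* Every out-degree is smaller than #|D|, so the initial value does not affect
   the minimum when D has a vertex; the empty digraph gets value 0. *)
Definition min_outdeg (D : digraph) : nat := \big[minn/#|D|]_(v : D) outdeg v.

Definition dicycle (D : digraph) (c : seq D) : bool :=
  (0 < size c) && ucycleb (@arc D) c.

(* None stands for +oo.  Directed cycles have at most #|D| vertices, and the
   candidate lengths are listed in increasing order. *)
Definition girth (D : digraph) : option nat :=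
  ohead [seq n <- iota 1 #|D| | [exists c : n.-tuple D, dicycle c]].

Definition girth_geq (D : digraph) (g : nat) : bool :=
  if girth D is Some n then g <= n else true.

(* Finite loopless digraphs that may have parallel arcs: this is needed for
   C(1,1), which consists of two parallel arcs. *)
Record multidigraph := Multidigraph {
  mvertex : finType;
  marc : finType;
  mtail : marc -> mvertex;
  mhead : marc -> mvertex;
  marc_loopless : forall a, mtail a != mhead a
}.

(* The arcs of the directed path with vertex sequence x :: p. *)
Definition path_arcs (T : Type) (x : T) (p : seq T) : seq (T * T) :=
  zip (x :: p) p.

(* S is obtained from F by replacing every arc a by the directed path with
   vertex sequence b (mtail a) :: rcons (I a) (b (mhead a)), where I a lists the
   internal vertices.  The last clause says that S has no other arcs, and that
   different arcs of F (even parallel ones) do not share an arc of S. *)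
Definition is_subdivision (F : multidigraph) (S : digraph) : Prop :=
  exists (b : mvertex F -> S) (I : marc F -> seq S),
    let P a := rcons (I a) (b (mhead a)) in
    [/\ injective b,
        (forall a, path (@arc S) (b (mtail a)) (P a) /\ uniq (b (mtail a) :: P a)),
        ((forall a v, b v \notin I a) /\
         (forall a a' x, a != a' -> x \in I a -> x \notin I a')),
        (forall x, (exists v, x = b v) \/ (exists a, x \in I a)) &
        (forall x y, arc x y -> exists! a, (x, y) \in path_arcs (b (mtail a)) (P a))].

Definition embeds (S D : digraph) : Prop :=
  exists2 h : S -> D, injective h & forall x y, arc x y -> arc (h x) (h y).

Definition contains_subdivision (D : digraph) (F : multidigraph) : Prop :=
  exists2 S : digraph, is_subdivision F S & embeds S D.

Definition mader_bound (g : nat) (F : multidigraph) (m : nat) : Prop :=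
  forall D : digraph, m <= min_outdeg D -> girth_geq D g ->
    contains_subdivision D F.

Definition is_mader (g : nat) (F : multidigraph) (m : nat) : Prop :=
  mader_bound g F m /\ (forall m', mader_bound g F m' -> m <= m').

(* The i-th vertex of the path s, f 0, ..., f (k - 2), t of length k > 0. *)
Definition path_point (T : Type) (s t : T) (k : nat) (f : 'I_k.-1 -> T)
    (i : nat) : T :=
  if i is j.+1 then (if insub j is Some o then f o else t) else s.

Section TwoPaths.
Variables k l : nat.

(* inl false is the initial vertex and inl true the terminal vertex. *)
Definition Cvertex : finType := (bool + ('I_k.-1 + 'I_l.-1))%type.

Definition Cpoint1 : nat -> Cvertex :=
  path_point (inl false) (inl true) (fun o : 'I_k.-1 => inr (inl o)).
Definition Cpoint2 : nat -> Cvertex :=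
  path_point (inl false) (inl true) (fun o : 'I_l.-1 => inr (inr o)).

Definition Ctail (a : 'I_k + 'I_l) : Cvertex :=
  match a with inl i => Cpoint1 i | inr i => Cpoint2 i end.
Definition Chead (a : 'I_k + 'I_l) : Cvertex :=
  match a with inl i => Cpoint1 i.+1 | inr i => Cpoint2 i.+1 end.

Lemma C_loopless a : Ctail a != Chead a.
Proof.
case: a => -[[|i] Hi] /=; rewrite /Cpoint1 /Cpoint2 /=; case: insubP => //=.
- move=> o _ Ho; case: insubP => [o' _ Ho'|_] //.
  by apply/eqP => -[] /(congr1 val) /=; rewrite Ho Ho' => /eqP; rewrite ltn_eqF.
- by rewrite -ltnS prednK ?Hi // (leq_trans _ Hi).
- move=> o _ Ho; case: insubP => [o' _ Ho'|_] //.
  by apply/eqP => -[] /(congr1 val) /=; rewrite Ho Ho' => /eqP; rewrite ltn_eqF.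
- by rewrite -ltnS prednK ?Hi // (leq_trans _ Hi).
Qed.

(* Meant for k, l > 0. *)
Definition C : multidigraph := Multidigraph C_loopless.

End TwoPaths.

Lemma leq_min_outdeg (D : digraph) (m : nat) :
  (m <= min_outdeg D) = (m <= #|D|) && [forall v : D, m <= outdeg v].
Proof.
rewrite /min_outdeg; have -> : [forall v : D, m <= outdeg v] =
    \big[andb/true]_(v : D) (m <= outdeg v).
  by rewrite big_andE; apply: eq_forallb.
elim/big_rec2: _ => [|v b n _ IH]; first by rewrite andbT.
by rewrite leq_min IH andbCA.
Qed.

Lemma girth_geqP (D : digraph) (g : nat) :
  reflect (forall c : seq D, dicycle c -> g <= size c) (girth_geq D g).
Proof.
rewrite /girth_geq /girth; set s := filter _ _.
have mem_s n : n \in s -> exists2 c : seq D, dicycle c & size c = n.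
  by rewrite mem_filter => /andP[/existsP[c Hc] _]; exists c; rewrite ?size_tuple.
have s_mem (c : seq D) : dicycle c -> size c \in s.
  move=> Hc; rewrite mem_filter mem_iota; apply/andP; split.
    by apply/existsP; exists (in_tuple c).
  case/andP: Hc => -> /andP[_ Uc] /=; rewrite add1n ltnS.
  by rewrite -(card_uniqP Uc) max_card.
have: sorted leq s.
  by apply: sorted_filter; [exact: leq_trans | exact: iota_sorted].
case: s mem_s s_mem => [|n s] mem_s s_mem /=.
  by move=> _; constructor => c /s_mem.
move=> ps; apply: (iffP idP) => [Hg c /s_mem|H].
  rewrite inE => /predU1P[->//|Hs].
  by apply: leq_trans Hg _; move/(order_path_min leq_trans)/allP: ps; apply.
by have [|c /H Hc <-] := mem_s n; rewrite ?mem_head.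
Qed.

(* Main.v *)
(* Take a directed path [l] ending in [v] and an arc [v -> x] such that [v] can
   be reached from [x] outside [l], with [l] as long as possible.  If the part
   reachable from [x] outside [l] contained a directed cycle, [l] could be
   extended through [x] up to that cycle; so this part is acyclic, and all arcs
   leaving it end in [l].  From two out-neighbours of [x], always advancing the
   end that comes first in the acyclic order, out-degree 2 yields two disjoint
   paths to [l], one of them ending in [v]; the other one is prolonged to [v]
   along [l].  Each of these two [x]-[v] paths closes to a directed cycle with
   the arc [v -> x], so the girth makes both of them long.  Directed cycles show
   that out-degree 1 is not enough. *)

From mathcomp Require Import all_boot zify.
Require Import Defs.

Set Implicit Arguments.
Unset Strict Implicit.
Unset Printing Implicit Defensive.

(** * Acyclic relations and the rank they define *)

Definition acyclic (V : finType) (e : rel V) : bool :=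
  [forall y, forall z, e y z ==> ~~ connect e z y].

Lemma acyclicP (V : finType) (e : rel V) :
  reflect (forall y z, e y z -> ~~ connect e z y) (acyclic e).
Proof.
apply: (iffP forallP) => [ac y z|ac y]; first exact/implyP/(forallP (ac y)).
by apply/forallP => z; apply/implyP; exact: ac.
Qed.

(** The set reachable from [z] lies in the one reachable from [y] and misses [y]. Its cardinality
    thus replaces a topological order. *)
Lemma acyclic_rank (V : finType) (e : rel V) : acyclic e ->
  forall y z, e y z -> #|connect e z| < #|connect e y|.
Proof.
move=> /acyclicP ac y z eyz; apply: proper_card; apply/properP; split.
  by apply/subsetP => w; apply: connect_trans; exact: connect1.
by exists y; [exact: connect0 | exact: ac].
Qed.

Lemma connect_step (V : finType) (e : rel V) x y : connect e x y -> x != y ->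
  exists2 z, e x z & connect e z y.
Proof.
case/connectP=> -[|z p] /= => [_ -> /eqP//|/andP[exz zp] -> _].
by exists z => //; apply/connectP; exists p.
Qed.

(** * Disjoint paths to sinks in an acyclic relation *)

Section Leapfrog.
Variables (V : finType) (e : rel V) (t : V).
Hypothesis ac : acyclic e.
Hypothesis two_out : forall y z, e y z -> forall b, exists2 z', e y z' & z' != b.
Hypothesis t_sink : forall y, ~~ e t y.

Let sink y := [forall z, ~~ e y z].
Let rk y := #|connect e y|.

Let path_rank_lt y p z : path e y p -> z \in p -> rk z < rk y.
Proof.
elim: p y => //= w p IH y /andP[/(acyclic_rank ac) lt_wy wp].
rewrite inE => /predU1P[->//|zp]; exact: ltn_trans (IH _ wp zp) lt_wy.
Qed.

Let sink_connect y z : sink y -> connect e y z -> y = z.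
Proof.
move=> /forallP sy cyz; apply/eqP; apply: contraT => nyz.
by have [w eyw] := connect_step cyz nyz; rewrite (negPf (sy w)) in eyw.
Qed.

(* Always advance the end of larger rank: ranks decrease strictly along paths,
   so the vertex left behind is never visited again by either path. *)
Lemma leapfrog a b : a != b -> connect e a t || connect e b t ->
  exists p q, [/\ path e a p, path e b q, uniq ((a :: p) ++ (b :: q)),
    sink (last a p) && sink (last b q) & (last a p == t) || (last b q == t)].
Proof.
have [n] := ubnP (rk a + rk b); elim: n a b => // n IH a b.
wlog le_ba : a b / rk b <= rk a => [W|] lt_n neq_ab ct.
  case/orP: (leq_total (rk b) (rk a)) => le; first exact: W.
  have [|||q [p [bq ap U sk lst]]] := W b a le.
  - by rewrite addnC.
  - by rewrite eq_sym.
  - by rewrite orbC.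
  - by exists p, q; split; rewrite 1?uniq_catC // 1?andbC 1?orbC.
(* A sink reaches only itself, so its rank is 1; then [b], of no larger rank, is a sink too, and
   empty paths do. *)
have [sk_a|/forallPn[a0 /negPn ea0]] := boolP (sink a).
  have rk_a : rk a = 1.
    rewrite /rk -(card1 a); apply: eq_card => z; apply/idP/idP.
      by move/(sink_connect sk_a)->; rewrite inE.
    by rewrite inE => /eqP->; exact: connect0.
  have sk_b : sink b.
    apply/forallP => z; apply/negP => /(acyclic_rank ac) lt_zb.
    have : 0 < rk z by apply/card_gt0P; exists z; exact: connect0.
    by move: le_ba lt_zb; rewrite rk_a /rk; lia.
  exists [::], [::]; rewrite /= inE neq_ab sk_a sk_b; split=> //.
  by case/orP: ct => [/(sink_connect sk_a)|/(sink_connect sk_b)] ->;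
    rewrite eqxx ?orbT.
(* If [b] reaches [t], any successor of [a] other than [b] will do. Otherwise take the next vertex
   towards [t]; it is not [b], which does not reach [t]. *)
have [a' eaa' /andP[neq_a'b ct']] :
    exists2 a', e a a' & (a' != b) && (connect e a' t || connect e b t).
  have [cb|ncb] := boolP (connect e b t).
    by have [a' ? ?] := two_out ea0 b; exists a' => //; rewrite orbT andbT.
  move: ct; rewrite (negPf ncb) orbF => ca.
  have [|a' eaa' ca'] := connect_step ca.
    by apply: contraTneq ea0 => ->; exact: t_sink.
  by exists a' => //; rewrite ca' andbT; apply: contraNneq ncb => <-.
have rk_a' := acyclic_rank ac eaa'.
have [|p [q [ap bq U sk lst]]] := IH a' b _ neq_a'b ct'.
  by move: lt_n rk_a'; rewrite /rk; lia.
exists (a' :: p), q; split=> //; first by rewrite /= eaa'.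
(* [a] is new: the first path continues with smaller ranks, and the second starts at [b], distinct
   from [a] and of no larger rank. *)
have aap : path e a (a' :: p) by rewrite /= eaa'.
rewrite cat_cons cons_uniq U andbT mem_cat negb_or; apply/andP; split.
  by apply/negP => /(path_rank_lt aap); rewrite ltnn.
rewrite inE (negPf neq_ab) /=; apply/negP => /(path_rank_lt bq).
by rewrite ltnNge le_ba.
Qed.

End Leapfrog.

(** * Longest paths with a way back outside them *)

Definition arc_off (D : digraph) (l : seq D) : rel D :=
  fun y z => (y \notin l) && arc y z.

(** Restricting tails to what [x] reaches makes acyclicity a statement about that part alone. *)
Definition arc_from (D : digraph) (l : seq D) (x : D) : rel D :=
  fun y z => connect (arc_off l) x y && arc_off l y z.

Lemma connect_arc_from (D : digraph) (l : seq D) (x y z : D) :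
  connect (arc_off l) x y -> connect (arc_off l) y z ->
  connect (arc_from l x) y z.
Proof.
move=> cxy /connectP[p yp ->]; elim: p y cxy yp => [|w p IH] y cxy //=.
case/andP=> eyw wp; apply: (connect_trans (y := w)).
  by apply: connect1; rewrite /arc_from cxy.
by apply: IH => //; apply: connect_trans cxy (connect1 eyw).
Qed.

Definition dipath (D : digraph) (l : seq D) : bool := sorted (@arc D) l && uniq l.

(** The path named [l] in the overview is [rcons l v] here. Only tails of [arc_off] must avoid it,
    so the way back may end in [v] but meets the path nowhere else. *)
Definition lollipop (D : digraph) (l : seq D) (v x : D) : bool :=
  dipath (rcons (rcons l v) x) && connect (arc_off (rcons l v)) x v.

Lemma path_arc_off_notin (D : digraph) (l : seq D) (x : D) p y :
  path (arc_off l) x p -> y \in belast x p -> y \notin l.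
Proof.
elim: p x => //= z p IH x /andP[/andP[xl _] zp].
by rewrite inE => /predU1P[->//|]; exact: IH.
Qed.

Lemma arc_off_sub (D : digraph) (l : seq D) : subrel (arc_off l) (@arc D).
Proof. by move=> y z /andP[]. Qed.

(** A shortest path [x :: p] in [arc_off l] to a vertex [y] on a cycle meets that cycle only in [y].
    Then [y] is the new [v], its successor [z] on the cycle the new [x'], and the rest of the cycle
    the way back. *)
Lemma lollipop_extend (D : digraph) (l : seq D) (x : D) :
  dipath (rcons l x) -> ~~ acyclic (arc_from l x) ->
  exists (l' : seq D) (v x' : D), lollipop l' v x' /\ size l <= size l'.
Proof.
move=> dlx nac; pose e := arc_off l.
pose cyclic y := [exists z, e y z && connect e z y].
pose P n := [exists p : n.-tuple D, path e x p && cyclic (last x p)].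
have exP : exists n, P n.
  have /forallPn[y /forallPn[z]] := nac.
  rewrite negb_imply negbK => /andP[/andP[cxy eyz] czy].
  have [p xp lp] := connectP cxy.
  exists (size p); apply/existsP; exists (in_tuple p); rewrite /= xp -lp.
  apply/existsP; exists z; rewrite /e eyz; apply: connect_sub czy => u w /andP[_].
  exact: connect1.
case: (ex_minnP exP) => n /existsP[[p sp] /=] /andP[xp cyc_p] min_n.
have minp p' : path e x p' -> cyclic (last x p') -> size p <= size p'.
  move=> xp' cp'; rewrite (eqP sp) min_n //; apply/existsP.
  by exists (in_tuple p'); rewrite /= xp'.
have {p sp xp cyc_p minp} [p [xp Uxp cyc_p minp]] : exists p,
    [/\ path e x p, uniq (x :: p), cyclic (last x p) &
        forall p', path e x p' -> cyclic (last x p') -> size p <= size p'].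
  case/shortenP: xp cyc_p => p' xp' Up' sub cyc_p'; exists p'; split=> // p2 xp2 cp2.
  apply: leq_trans (minp _ xp2 cp2); apply: uniq_leq_size => //.
  by case/andP: Up'.
have [y ly] : exists y, last x p = y by exists (last x p).
rewrite ly in cyc_p; case/existsP: (cyc_p) => z /andP[eyz].
case/connectP=> c0 /shortenP[c zc Uzc _] lc {c0}.
(* A vertex of the cycle met before [y] would itself lie on a cycle and be reached by a shorter
   path. *)
have onlyy w : w \in z :: c -> w \in x :: p -> w = y.
  move=> wc wp; apply/eqP; apply: contraT => neq_wy.
  have [cwy czw] : connect e w y /\ connect e z w.
    case/splitPl: wc zc lc => c1 c2 lc1; rewrite cat_path last_cat lc1.
    case/andP=> zc1 wc2 ->; split; apply/connectP; by [exists c2 | exists c1].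
  have [z' ewz' cz'y] := connect_step cwy neq_wy.
  have cyc_w : cyclic w.
    apply/existsP; exists z'; rewrite ewz'; apply: connect_trans cz'y _.
    exact: connect_trans (connect1 eyz) czw.
  case/splitPl: wp xp ly minp {Uxp} => p1 p2 lp1; rewrite cat_path last_cat lp1.
  case/andP=> xp1 _ lp2 /(_ p1 xp1); rewrite lp1 size_cat => /(_ cyc_w).
  case: p2 lp2 => [/= wy|? ? _]; first by rewrite wy eqxx in neq_wy.
  by rewrite /= addnS ltnNge leq_addr.
have ynl : y \notin l by case/andP: eyz.
have ayz : arc y z by exact: arc_off_sub eyz.
have neq_zy : z != y by apply: contraTneq ayz => ->; rewrite arc_irrefl.
have mem_lastI (u : D) q w : w \in u :: q -> w \in belast u q \/ w = last u q.
  by rewrite lastI mem_rcons inE => /predU1P[]; auto.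
have znl : z \notin l.
  by case: c zc lc {Uzc onlyy} => [_ /= zy|w c /= /andP[/andP[]]] //;
     rewrite zy eqxx in neq_zy.
have pnl w : w \in x :: p -> w \notin l.
  by case/mem_lastI => [|->]; [exact: path_arc_off_notin xp | rewrite ly].
have zxp : z \notin x :: p.
  by apply: contra neq_zy => /onlyy->; rewrite ?mem_head.
have [sl Ul] := andP dlx.
have Ulp : uniq (l ++ x :: p).
  rewrite cat_uniq Uxp andbT; move: Ul; rewrite rcons_uniq => /andP[_ ->].
  by apply/hasPn => w /pnl.
have def_l : rcons (l ++ belast x p) y = l ++ x :: p.
  by rewrite rcons_cat -ly -lastI.
exists (l ++ belast x p), y, z; split; last by rewrite size_cat leq_addr.
rewrite /lollipop def_l; apply/andP; split.
  rewrite /dipath rcons_uniq Ulp mem_cat negb_or znl zxp !andbT.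
  rewrite rcons_cat -cat_rcons; case: (l) sl => [|u l'] /= sl.
    by rewrite rcons_path (sub_path (@arc_off_sub _ _) xp) ly.
  by rewrite cat_path sl last_rcons rcons_path (sub_path (@arc_off_sub _ _) xp) ly.
apply/connectP; exists c => //.
(* The way back avoids the lengthened path until it reaches [y], so it remains a path when [l] grows
   to [l ++ x :: p]. *)
have bel w : w \in belast z c -> w \notin l ++ x :: p.
  move=> wb; rewrite mem_cat negb_or (path_arc_off_notin zc wb) /=.
  have wc : w \in z :: c by rewrite mem_belast.
  apply/negP => /(onlyy _ wc) wy; move: Uzc; rewrite lastI rcons_uniq -lc -wy.
  by rewrite wb.
elim: c z zc bel {lc onlyy neq_zy znl zxp Uzc ayz eyz} => //= w c IH z.
case/andP=> ezw wc bel; apply/andP; split.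
  by rewrite /arc_off bel ?mem_head // (arc_off_sub ezw).
by apply: IH => // u ub; apply: bel; rewrite inE ub orbT.
Qed.

Lemma outdeg_gt1 (D : digraph) (y b : D) : 1 < outdeg y ->
  exists2 z, arc y z & z != b.
Proof.
rewrite /outdeg (cardsD1 b) => gt1; have /card_gt0P[z] : 0 < #|[set w | arc y w] :\ b|.
  by move: gt1; case: (b \in _); lia.
by rewrite !inE => /andP[]; exists z.
Qed.

(** [lollipop_extend], applied to [rcons l v], makes [l] strictly longer; this stops because a path
    has at most [#|D|] vertices. *)
Lemma acyclic_lollipop (D : digraph) : 0 < #|D| -> (forall v : D, 1 < outdeg v) ->
  exists (l : seq D) (v x : D),
    lollipop l v x /\ acyclic (arc_from (rcons l v) x).
Proof.
move=> /card_gt0P[x0 _] deg2.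
(* To start: a reachable vertex of least rank has an out-neighbour, which acyclicity would give a
   smaller rank. *)
have nac0 : ~~ acyclic (arc_from [::] x0).
  apply/negP => ac; have C0 : connect (arc_off [::]) x0 x0 by exact: connect0.
  case: (arg_minnP (fun y => #|connect (arc_from [::] x0) y|) C0) => y Cy min_y.
  have [z ayz _] := outdeg_gt1 y (deg2 y).
  have Cz : connect (arc_off [::]) x0 z by apply: connect_trans Cy (connect1 ayz).
  have /(acyclic_rank ac) : arc_from [::] x0 y z by rewrite /arc_from Cy.
  by rewrite ltnNge min_y.
have [l [v [x [Hl _]]]] := lollipop_extend (isT : dipath (rcons [::] x0)) nac0.
have [n] := ubnP (#|D| - size l); elim: n => // n IH in l v x Hl *.
move=> lt_n; have [ac|nac] := boolP (acyclic (arc_from (rcons l v) x)).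
  by exists l, v, x.
have [dl _] := andP Hl; have [l' [v' [x' [Hl']]]] := lollipop_extend dl nac.
rewrite size_rcons => lt_l; apply: (IH _ _ _ Hl').
have : size l' < #|D|.
  case/andP: Hl' => /andP[_]; rewrite rcons_uniq => /andP[_ U] _.
  by rewrite -(size_rcons l' v') -(card_uniqP U) max_card.
by lia.
Qed.

(** * Two internally disjoint paths closed by one arc *)

Lemma two_dipaths (D : digraph) : 0 < #|D| -> (forall v : D, 1 < outdeg v) ->
  exists (s t : D) (I1 I2 : seq D),
    [/\ arc t s, path (@arc D) s (rcons I1 t), path (@arc D) s (rcons I2 t)
      & uniq (s :: t :: I1 ++ I2)].
Proof.
move=> D0 deg2; have [l [v [x [/andP[/andP[sL UL] cxv] ac]]]] := acyclic_lollipop D0 deg2.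
set L := rcons l v in sL UL cxv ac; set e := arc_from L x in ac.
have vL : v \in L by rewrite mem_rcons mem_head.
move: UL; rewrite rcons_uniq => /andP[xL UL].
have sub_e : subrel e (@arc D) by move=> y z /andP[_ /andP[]].
have avx : arc v x.
  by move: sL; rewrite /L -cats1 cat_rcons => /cat_sorted2[_] /= /andP[].
have {}sL : sorted (@arc D) L.
  by move: sL; rewrite -cats1 => /cat_sorted2[].
(* [e] restricts tails only, so a vertex with one [e]-successor keeps all its out-neighbours. *)
have two_out y z : e y z -> forall b, exists2 z', e y z' & z' != b.
  move=> /andP[cy /andP[yL _]] b; have [z' ayz' nb] := outdeg_gt1 b (deg2 y).
  by exists z' => //; rewrite /e /arc_from /arc_off cy yL.
have v_sink y : ~~ e v y by rewrite /e /arc_from /arc_off vL andbF.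
have neq_xv : x != v by apply: contraNneq xL => ->.
have [a exa cav] := connect_step (connect_arc_from (connect0 _ x) cxv) neq_xv.
have [b exb neq_ba] := two_out _ _ exa a.
have sub_off : subrel e (arc_off L) by move=> y z /andP[].
have bel y p w : path e y p -> w \in belast y p -> w \notin L.
  by move/(sub_path sub_off); exact: path_arc_off_notin.
(* Returning to [x] would close a cycle in [e]. *)
have xnotin y p : e x y -> path e y p -> x \notin y :: p.
  move=> exy yp; apply/negP => /splitPl H; case: H yp => p1 p2 lp1.
  rewrite cat_path => /andP[yp1 _]; have /acyclicP/(_ _ _ exy)/negP[] := ac.
  by apply/connectP; exists p1.
(* Outside [L], a vertex reachable from [x] keeps its out-arcs; hence a sink lies in [L]. *)
have sinkL y p : e x y -> path e y p -> [forall z, ~~ e (last y p) z] -> last y p \in L.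
  move=> exy yp /forallP sk; apply: contraT => nL.
  have [z az _] := outdeg_gt1 x (deg2 (last y p)).
  have := sk z; rewrite /e /arc_from /arc_off nL az !andbT; case/negP.
  have /connect_sub -> // : connect e x (last y p).
    by apply: connect_trans (connect1 exy) _; apply/connectP; exists p.
  by move=> u w /andP[_]; exact: connect1.
(* [leapfrog] leaves open which path ends in [v]; this claim serves both cases. *)
have finish a' b' p q : e x a' -> e x b' -> path e a' p -> path e b' q ->
    uniq ((a' :: p) ++ (b' :: q)) -> last a' p = v -> last b' q \in L ->
    exists (s t : D) (I1 I2 : seq D),
      [/\ arc t s, path (@arc D) s (rcons I1 t), path (@arc D) s (rcons I2 t)
      & uniq (s :: t :: I1 ++ I2)].
  move=> exa' exb' ap bq U lp lq.
  have lqv : last b' q != v.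
    apply: contraTneq U => lqv; rewrite cat_uniq; apply/nandP; right; apply/nandP; left.
    by rewrite negbK; apply/hasP; exists v; [rewrite -lqv|rewrite -lp]; exact: mem_last.
  have [L1 [L2 defL]] : exists L1 L2, L = L1 ++ last b' q :: L2.
    by case/splitPr: lq => L1 L2; exists L1, L2.
  (* [L] ends in [v], which is not [last b' q], so [L2] is nonempty and ends in [v]. *)
  case: (lastP L2) defL => [|L2' v'] defL.
    by move: defL; rewrite cats1 => /rcons_inj[_ /esym/eqP]; rewrite (negPf lqv).
  have def_v : v' = v by move: defL; rewrite -rcons_cons -rcons_cat => /rcons_inj[].
  (* [belast] removes the end [v] from the first path; [L2'] is the part of [L] strictly between
     [last b' q] and [v]. *)
  subst v'; exists x, v, (belast a' p), (b' :: q ++ L2').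
  have L2L w : w \in L2' -> [/\ w \in L, w != v & w != last b' q].
    move=> wL2; split; first by rewrite defL mem_cat inE mem_rcons inE wL2 !orbT.
      apply: contraTneq UL => wv; rewrite defL cat_uniq cons_uniq rcons_uniq -wv wL2.
      by rewrite !andbF.
    apply: contraTneq UL => wl; rewrite defL cat_uniq cons_uniq mem_rcons inE -wl wL2.
    by rewrite orbT !andbF.
  have notL2 w y r : e x y -> path e y r -> w \in y :: r ->
      last y r \in [:: v; last b' q] -> w \notin L2'.
    move=> exy yr; rewrite lastI mem_rcons inE => /predU1P[->|wb] lr.
      by apply/negP => /L2L[_ nv nl]; move: lr; rewrite !inE (negPf nv) (negPf nl).
    by apply/negP => /L2L[wL _ _]; move: (bel _ _ _ yr wb); rewrite wL.
  have path_arc y r : e x y -> path e y r -> path (@arc D) x (y :: r).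
    by move=> exy yr /=; rewrite (sub_e _ _ exy) (sub_path sub_e yr).
  split=> //.
  - by rewrite -lp -lastI; exact: path_arc.
  - rewrite rcons_cons rcons_cat -cat_cons cat_path path_arc //=.
    by move: sL; rewrite defL => /cat_sorted2[].
  (* Moving [v] behind [belast a' p] restores the leapfrog path [a' :: p]. *)
  have -> : uniq (x :: v :: belast a' p ++ b' :: q ++ L2') =
            uniq (x :: (a' :: p) ++ (b' :: q) ++ L2').
    by apply: perm_uniq; rewrite perm_cons (lastI a') lp cat_rcons -(cat1s v (_ ++ _)) perm_catCA.
  rewrite catA cons_uniq cat_uniq U andTb; apply/and3P; split.
  - rewrite 2!mem_cat; apply/norP; split; last by apply: contra xL => /L2L[].
    by apply/norP; split; exact: xnotin.
  - apply/hasPn => w wL2; rewrite mem_cat; apply/norP; split.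
      apply/negP => /(notL2 _ _ _ exa' ap) H; move: (H).
      by rewrite lp mem_head wL2 => /(_ isT).
    apply/negP => /(notL2 _ _ _ exb' bq) H; move: (H).
    by rewrite !inE eqxx orbT wL2 => /(_ isT).
  - move: UL; rewrite defL cat_uniq cons_uniq rcons_uniq.
    by case/and5P.
have [||p [q [ap bq U /andP[skp skq] lst]]] :=
  leapfrog ac two_out v_sink (a := a) (b := b).
- by rewrite eq_sym.
- by rewrite cav.
case/orP: lst => /eqP lst; first exact: finish exa exb ap bq U lst (sinkL _ _ exb bq skq).
by apply: finish exb exa bq ap _ lst (sinkL _ _ exa ap skp); rewrite uniq_catC.
Qed.

(** * Subdivisions built from paths of a digraph *)

Lemma path_path_arcs (T : eqType) (e : rel T) x p y z :
  path e x p -> (y, z) \in path_arcs x p -> e y z.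
Proof.
rewrite /path_arcs; elim: p x => //= w p IH x /andP[exw wp].
by rewrite inE => /predU1P[[-> ->]//|]; exact: IH.
Qed.

Lemma path_arcs_path (T : eqType) (e : rel T) x p :
  (forall y z, (y, z) \in path_arcs x p -> e y z) -> path e x p.
Proof.
rewrite /path_arcs; elim: p x => //= w p IH x H; rewrite H ?mem_head //=.
by apply: IH => y z yz; apply: H; rewrite inE yz orbT.
Qed.

Lemma path_arcs_map (T U : eqType) (f : T -> U) x p :
  path_arcs (f x) (map f p) = [seq (f yz.1, f yz.2) | yz <- path_arcs x p].
Proof. by rewrite /path_arcs; elim: p x => //= w p IH x; rewrite -IH. Qed.

Lemma path_arcs_mem (T : eqType) (x : T) p y z :
  (y, z) \in path_arcs x p -> (y \in belast x p) && (z \in p).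
Proof.
rewrite /path_arcs; elim: p x => //= w p IH x.
rewrite in_cons => /predU1P[[-> ->]|/IH/andP[yp zp]]; first by rewrite eqxx mem_head.
by rewrite !inE yp zp !orbT.
Qed.

(** Unless [I] is empty, the first arc has its head in [I]; every later arc has its tail in [I]. *)
Lemma path_arcs_internal (T : eqType) (s t : T) I x y :
  (x, y) \in path_arcs s (rcons I t) -> x \notin I -> y \notin I ->
  [/\ I = [::], x = s & y = t].
Proof.
case: I => [|w I]; first by rewrite /path_arcs inE => /eqP[-> ->].
rewrite rcons_cons /path_arcs /= inE => /predU1P[[_ ->]|].
  by move=> _ /negP[]; exact: mem_head.
by case/path_arcs_mem/andP=> [xI _] /negP[]; rewrite belast_rcons in xI.
Qed.

Section SubdivisionInDigraph.
Variables (D : digraph) (F : multidigraph).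
Variables (b : mvertex F -> D) (I : marc F -> seq D).
Let P a := rcons (I a) (b (mhead a)).
Hypothesis inj_b : injective b.
Hypothesis arcP : forall a, path (@arc D) (b (mtail a)) (P a).
Hypothesis uniqI : forall a, uniq (I a).
Hypothesis bI : forall a v, b v \notin I a.
Hypothesis disjI : forall a a' x, a != a' -> x \in I a -> x \notin I a'.
(** Two parallel arcs of [F], each replaced by a single arc, would share that arc in [D]. *)
Hypothesis no_parallel : forall a a', I a = [::] -> I a' = [::] ->
  mtail a = mtail a' -> mhead a = mhead a' -> a = a'.

Let uniqP a : uniq (b (mtail a) :: P a).
Proof.
rewrite /= /P rcons_uniq bI uniqI mem_rcons inE negb_or bI !andbT.
by rewrite (inj_eq inj_b) marc_loopless.
Qed.

(** An end interior to one path lies on no other path. If neither end is interior, both paths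
    consist of this single arc and [no_parallel] applies. *)
Let arc_uniq a a' x y : (x, y) \in path_arcs (b (mtail a)) (P a) ->
  (x, y) \in path_arcs (b (mtail a')) (P a') -> a = a'.
Proof.
have inP a0 x0 : x0 \in b (mtail a0) :: P a0 ->
    [\/ x0 = b (mtail a0), x0 = b (mhead a0) | x0 \in I a0].
  rewrite inE mem_rcons inE => /or3P[/eqP|/eqP|]; by [constructor 1|constructor 2|constructor 3].
have key a1 a2 x0 : x0 \in I a1 -> x0 \in b (mtail a2) :: P a2 -> a1 = a2.
  move=> x1 /inP[e|e|x2].
  - by rewrite e (negPf (bI _ _)) in x1.
  - by rewrite e (negPf (bI _ _)) in x1.
  by apply/eqP; apply: contraT => /disjI/(_ x1); rewrite x2.
have mem a0 : (x, y) \in path_arcs (b (mtail a0)) (P a0) ->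
    (x \in b (mtail a0) :: P a0) && (y \in b (mtail a0) :: P a0).
  by case/path_arcs_mem/andP=> /mem_belast-> yP; rewrite inE yP orbT.
move=> xy xy'; have /andP[xp yp] := mem _ xy; have /andP[xp' yp'] := mem _ xy'.
have [xi|nx] := boolP (x \in I a); first exact: key xp'.
have [yi|ny] := boolP (y \in I a); first exact: key yp'.
have [xi|nx'] := boolP (x \in I a'); first by apply/esym; exact: key xp.
have [yi|ny'] := boolP (y \in I a'); first by apply/esym; exact: key yp.
have [Ia xt yh] := path_arcs_internal xy nx ny.
have [Ia' xt' yh'] := path_arcs_internal xy' nx' ny'.
by apply: no_parallel => //; apply: inj_b; rewrite -?xt -?yh.
Qed.

Let used (x : D) := [exists v, b v == x] || [exists a, x \in I a].

Let used_b v : used (b v).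
Proof. by apply/orP; left; apply/existsP; exists v. Qed.

Let used_I a : all used (I a).
Proof. by apply/allP => x xI; apply/orP; right; apply/existsP; exists a. Qed.

(** Only arcs of the chosen paths are kept; the subdigraph induced by the used vertices may have
    more. *)
Let sub_arc : rel {x : D | used x} := fun x y =>
  [exists a, (val x, val y) \in path_arcs (b (mtail a)) (P a)].

Let sub_arc_arc x y : sub_arc x y -> arc (val x) (val y).
Proof. by case/existsP=> a; exact: path_path_arcs (arcP a). Qed.

Let sub_arc_irrefl : irreflexive sub_arc.
Proof. by move=> x; apply: contraFF (arc_irrefl (val x)); exact: sub_arc_arc. Qed.

Lemma contains_subdivisionI : contains_subdivision D F.
Proof.
exists (Digraph sub_arc_irrefl); last by exists val => //; exact: val_inj.
pose b' v : {x : D | used x} := Sub (b v) (used_b v).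
pose I' a : seq {x : D | used x} := pmap insub (I a).
have valI' a : map val (I' a) = I a.
  rewrite /I' (pmap_filter (insubK _)); apply/all_filterP; apply: sub_all (used_I a).
  by move=> x ux; rewrite insubT.
have memI' a (x : {x : D | used x}) : (x \in I' a) = (val x \in I a).
  by rewrite -valI' mem_map //; exact: val_inj.
have valP' a : map val (rcons (I' a) (b' (mhead a))) = P a.
  by rewrite map_rcons valI'.
have memP' a x y : ((x, y) \in path_arcs (b' (mtail a)) (rcons (I' a) (b' (mhead a))))
    = ((val x, val y) \in path_arcs (b (mtail a)) (P a)).
  rewrite -valP' -[b (mtail a)]/(val (b' (mtail a))) path_arcs_map.
  apply/idP/idP => [xy|/mapP[[x' y'] xy' [/val_inj-> /val_inj->]]] //.
  by apply/mapP; exists (x, y).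
exists b', I'; split.
- by move=> v w /(congr1 val)/inj_b.
- move=> a; split; last by rewrite -(map_inj_uniq val_inj) /= valP'; exact: uniqP.
  by apply: path_arcs_path => x y; rewrite memP' => xy; apply/existsP; exists a.
- split=> [a v|a a' x naa']; rewrite !memI' //=; exact: disjI.
- move=> [x ux]; case/orP: (ux) => [/existsP[v /eqP bv]|/existsP[a xa]].
    by left; exists v; apply: val_inj.
  by right; exists a; rewrite memI'.
move=> x y /existsP[a xy]; exists a; split=> [|a']; rewrite memP' //.
exact: arc_uniq.
Qed.

End SubdivisionInDigraph.

(** * Out-degree one does not suffice *)

Lemma not_contains_subdivision_outdeg1 (D : digraph) (F : multidigraph) (a a' : marc F) :
  a != a' -> mtail a = mtail a' -> (forall x y z : D, arc x y -> arc x z -> y = z) ->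
  ~ contains_subdivision D F.
Proof.
move=> naa' taa' out1 [S [b [I [_ pathP _ _ arcU]]] [h inj_h arc_h]].
have first a0 : exists y, arc (b (mtail a0)) y /\
    (b (mtail a0), y) \in path_arcs (b (mtail a0)) (rcons (I a0) (b (mhead a0))).
  case: (pathP a0); rewrite /path_arcs; case: (I a0) => [|y J] /= /andP[ay _] _.
    by exists (b (mhead a0)); rewrite mem_head.
  by exists y; rewrite mem_head.
(* The first arcs of the two paths leave the same vertex, so they coincide in [D]; but an arc of the
   subdivision lies on one path only. *)
have [y [ay my]] := first a; have [z [az mz]] := first a'.
rewrite -taa' in az mz; have yz : y = z.
  by apply: inj_h; apply: out1 (arc_h _ _ ay) (arc_h _ _ az).
have [a0 [_ a0U]] := arcU _ _ ay; move/eqP: naa'; apply.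
by rewrite -(a0U a) // -(a0U a') // yz -taa'.
Qed.

Section DirectedCycle.
Variable n : nat.

Let succ_rel : rel 'I_n.+2 := fun i j => ordS i == j.

Lemma succ_rel_irrefl : irreflexive succ_rel.
Proof.
move=> i; apply/negP => /eqP/(congr1 val) /=.
have [lt_i|] := ltnP i.+1 n.+2; first by rewrite modn_small //; lia.
have := ltn_ord i => lt1 le1; have -> : i.+1 = n.+2 by lia.
by rewrite modnn; lia.
Qed.

Definition directed_cycle : digraph := Digraph succ_rel_irrefl.

Lemma directed_cycle_out (x y z : directed_cycle) : arc x y -> arc x z -> y = z.
Proof. by move=> /eqP<- /eqP<-. Qed.

Lemma directed_cycle_min_outdeg : 0 < min_outdeg directed_cycle.
Proof.
rewrite leq_min_outdeg card_ord /=; apply/forallP => v.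
by apply/card_gt0P; exists (ordS v); rewrite inE /= /succ_rel.
Qed.

(** The vertex set of a cycle is closed under the cyclic successor, so it contains all [n.+2]
    vertices. *)
Lemma directed_cycle_girth : girth_geq directed_cycle n.+2.
Proof.
apply/girth_geqP => c /andP[c0 /andP[cc Uc]].
have step x : x \in c -> ordS x \in c.
  by move=> xc; have /eqP-> := next_cycle cc xc; rewrite mem_next.
case: c c0 cc Uc step => // x c _ _ _ step.
have all_in i : iter i (@ordS n.+2) x \in x :: c.
  by elim: i => [|i IH]; [rewrite mem_head | exact: step].
rewrite -[n.+2]card_ord cardE; apply: uniq_leq_size (enum_uniq _) _ => y _.
(* Going round by [n.+2 - x] steps leads from [x] to 0, and [y] more steps lead to [y]. *)
suff -> : y = iter (y + (n.+2 - x)) (@ordS n.+2) x by [].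
have val_iter i : val (iter i (@ordS n.+2) x) = (x + i) %% n.+2.
  elim: i => [|i IH] /=; first by rewrite addn0 modn_small.
  by rewrite IH -addn1 modnDml addn1 addnS.
apply: val_inj; rewrite val_iter; have := ltn_ord x; have := ltn_ord y => ly lx.
have -> : x + (y + (n.+2 - x)) = y + n.+2 by lia.
by rewrite modnDr modn_small.
Qed.

End DirectedCycle.

(** * Two long paths with common ends as a subdivision of [C k k] *)

Section LongTwoPaths.
Variables (D : digraph) (k : nat) (s t : D) (I1 I2 : seq D).
Hypothesis hk : 0 < k.
Hypothesis path1 : path (@arc D) s (rcons I1 t).
Hypothesis path2 : path (@arc D) s (rcons I2 t).
Hypothesis uniq12 : uniq (s :: t :: I1 ++ I2).
Hypothesis long1 : k <= size I1.
Hypothesis long2 : k <= size I2.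

Let b (v : mvertex (C k k)) : D :=
  match v with
  | inl false => s
  | inl true => t
  | inr (inl o) => nth s I1 o
  | inr (inr o) => nth s I2 o
  end.

(* All the surplus length goes to the last arc of each of the two paths. *)
Let tail_part (J : seq D) (i : nat) : seq D :=
  if i.+1 == k then drop i J else [::].

Let I (a : marc (C k k)) : seq D :=
  match a with inl i => tail_part I1 i | inr i => tail_part I2 i end.

(** After its first [i] arcs the path still has to run through [drop i J] to [t]: the last segment
    takes all of this, any other only the first arc. *)
Let path_segment (J : seq D) (i : nat) : i < k -> k <= size J ->
  path (@arc D) s (rcons J t) ->
  path (@arc D) (nth s (s :: J) i)
    (rcons (tail_part J i) (if i.+1 == k then t else nth s J i)).
Proof.
move=> lt_ik le_k; rewrite -{1}(cat_take_drop i J) rcons_cat cat_path.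
have -> : last s (take i J) = nth s (s :: J) i.
  rewrite -[LHS](nth_last s (s :: take i J)) /= size_takel; last by lia.
  by case: (i) => //= j; rewrite nth_take.
case/andP=> _; rewrite /tail_part; case: ifP => // _.
by rewrite (drop_nth s) /=; [case/andP=> ->|lia].
Qed.

Let b_Cpoint1 i : i < k -> b (Cpoint1 k k i) = nth s (s :: I1) i.
Proof. by case: i => // i lt_ik; rewrite /Cpoint1 /= insubT //=; lia. Qed.

Let b_Cpoint2 i : i < k -> b (Cpoint2 k k i) = nth s (s :: I2) i.
Proof. by case: i => // i lt_ik; rewrite /Cpoint2 /= insubT //=; lia. Qed.

Let b_Cpoint1S i : i < k ->
  b (Cpoint1 k k i.+1) = if i.+1 == k then t else nth s I1 i.
Proof.
move=> lt_ik; case: eqP => ik; last by rewrite b_Cpoint1 //; lia.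
by rewrite /Cpoint1 /= insubF //; lia.
Qed.

Let b_Cpoint2S i : i < k ->
  b (Cpoint2 k k i.+1) = if i.+1 == k then t else nth s I2 i.
Proof.
move=> lt_ik; case: eqP => ik; last by rewrite b_Cpoint2 //; lia.
by rewrite /Cpoint2 /= insubF //; lia.
Qed.

Let tail_part_mem J i x : x \in tail_part J i -> i.+1 = k /\ x \in drop k.-1 J.
Proof. by rewrite /tail_part; case: eqP => // <-. Qed.

Lemma contains_subdivision_C : contains_subdivision D (C k k).
Proof.
move: uniq12; rewrite !cons_uniq inE mem_cat !negb_or cat_uniq.
case/and3P=> /and3P[neq_st s1 s2]; rewrite mem_cat negb_or => /andP[t1 t2].
case/and3P=> U1 dis12 U2.
have d12 x : x \in I1 -> x \in I2 -> False.
  by move=> x1 x2; move/hasPn: dis12 => /(_ x x2) /=; rewrite x1.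
have lt_ok (o : 'I_k.-1) : o < k.
  exact: leq_trans (ltn_ord o) (leq_pred k).
have m1 (o : 'I_k.-1) : nth s I1 o \in I1.
  by rewrite mem_nth //; exact: leq_trans (lt_ok o) long1.
have m2 (o : 'I_k.-1) : nth s I2 o \in I2.
  by rewrite mem_nth //; exact: leq_trans (lt_ok o) long2.
(* Branch vertices are among the first [k.-1] entries, the surplus among the later ones. *)
have no_drop J (o : 'I_k.-1) : uniq J -> k <= size J -> nth s J o \notin drop k.-1 J.
  move=> U leJ; have lt_o := ltn_ord o; have le_J := leq_trans (leq_pred k) leJ.
  rewrite -[X in nth s X o](cat_take_drop k.-1 J) nth_cat size_takel // lt_o.
  move: U; rewrite -{1}(cat_take_drop k.-1 J) cat_uniq.
  by case/and3P=> _ /hasPn H _; apply/negP => /H /=; rewrite mem_nth // size_takel.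
(* As [k <= size J], the last segment has an interior vertex. For [k = 1] this separates the two
   parallel arcs. *)
have tail_nil J (i : 'I_k) : tail_part J i = [::] -> k <= size J -> i < k.-1.
  rewrite /tail_part => tnil leJ; have lti := ltn_ord i.
  rewrite -ltnS prednK // ltn_neqAle lti andbT; case: eqP tnil => // _ /(congr1 size)/eqP.
  by rewrite size_drop subn_eq0 leqNgt (leq_trans lti leJ).
apply: (@contains_subdivisionI D (C k k) b I).
- move=> [[]|[o|o]] [[]|[o'|o']] //= e.
  + by rewrite e eqxx in neq_st.
  + by rewrite e m1 in t1.
  + by rewrite e m2 in t2.
  + by rewrite e eqxx in neq_st.
  + by rewrite e m1 in s1.
  + by rewrite e m2 in s2.
  + by rewrite -e m1 in t1.
  + by rewrite -e m1 in s1.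
  + have := ltn_ord o; have := ltn_ord o' => lo' lo.
    congr (inr (inl _)); apply/val_inj/eqP; rewrite -(nth_uniq s _ _ U1) ?e //;
      exact: leq_trans (lt_ok _) _.
  + by case: (d12 _ (m1 o)); rewrite e.
  + by rewrite -e m2 in t2.
  + by rewrite -e m2 in s2.
  + by case: (d12 _ (m1 o')); rewrite -e.
  + have := ltn_ord o; have := ltn_ord o' => lo' lo.
    congr (inr (inr _)); apply/val_inj/eqP; rewrite -(nth_uniq s _ _ U2) ?e //;
      exact: leq_trans (lt_ok _) _.
- move=> [i|i]; rewrite [mtail _]/= [mhead _]/=.
  + by rewrite b_Cpoint1 // b_Cpoint1S //; exact: path_segment.
  + by rewrite b_Cpoint2 // b_Cpoint2S //; exact: path_segment.
- by move=> [i|i] /=; rewrite /tail_part; case: ifP => // _; exact: drop_uniq.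
- move=> [i|i] v; apply/negP => /= /tail_part_mem[_ bv]; move: (mem_drop bv).
  + case: v bv => [[]|[o|o]] /= bv; rewrite ?(negPf t1) ?(negPf s1) //.
      by rewrite (negPf (no_drop _ _ U1 long1)) in bv.
    by move/d12; apply.
  + case: v bv => [[]|[o|o]] /= bv; rewrite ?(negPf t2) ?(negPf s2) //.
      by move/(d12 _ (m1 o)).
    by rewrite (negPf (no_drop _ _ U2 long2)) in bv.
- move=> [i|i] [j|j] x nij /= /tail_part_mem[ik xi]; apply/negP => /tail_part_mem[jk xj].
  + by case/eqP: nij; congr inl; apply/val_inj/succn_inj; rewrite ik jk.
  + exact: d12 (mem_drop xi) (mem_drop xj).
  + exact: d12 (mem_drop xj) (mem_drop xi).
  + by case/eqP: nij; congr inr; apply/val_inj/succn_inj; rewrite ik jk.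
(* An arc with empty interior is not the last of its path, so its head is an internal vertex of
   [C k k] and determines it. *)
have Cpoint_inj (i j : 'I_k) : i < k.-1 -> j < k.-1 ->
    [/\ Cpoint1 k k i.+1 = Cpoint1 k k j.+1 -> i = j,
        Cpoint2 k k i.+1 = Cpoint2 k k j.+1 -> i = j,
        Cpoint1 k k i.+1 <> Cpoint2 k k j.+1 &
        Cpoint2 k k i.+1 <> Cpoint1 k k j.+1].
  move=> lti ltj; rewrite /Cpoint1 /Cpoint2 /= !insubT.
  by split=> // -[ij]; apply: val_inj.
move=> [i|i] [j|j] /= /tail_nil lti /tail_nil ltj _;
  have [] := Cpoint_inj i j (lti _) (ltj _) => // eq1 eq2 neq12 neq21.
- by move/eq1->.
- by move/eq2->.
Qed.

End LongTwoPaths.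

Theorem theorem1p2 (k : nat) (hk : 0 < k) : is_mader (4 * k + 2) (C k k) 2.
Proof.
split=> [D|m bound_m].
  rewrite leq_min_outdeg => /andP[D2 /forallP deg2] /girth_geqP girthD.
  have [s [t [I1 [I2 [ats p1 p2 U]]]]] := two_dipaths (ltnW D2) deg2.
  (* With the arc from [t] to [s] the path closes to a cycle on [size J + 2] vertices, so [size J]
     is at least [4 * k]. *)
  have long J : path (@arc D) s (rcons J t) -> uniq (s :: t :: J) -> k <= size J.
    move=> pJ UJ; have /girthD : dicycle (s :: rcons J t).
      rewrite /dicycle /ucycleb /= rcons_path pJ last_rcons ats /=.
      by move: UJ; rewrite rcons_uniq mem_rcons.
    by rewrite /= size_rcons; lia.
  have sub12 J : subseq J (I1 ++ I2) -> uniq (s :: t :: J).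
    by move=> sJ; apply: subseq_uniq U; rewrite /= !eqxx.
  apply: (contains_subdivision_C hk p1 p2 U); apply: long => //; apply: sub12.
    exact: prefix_subseq.
  exact: suffix_subseq.
(* A bound [m] of at most 1 would apply to the directed cycle on [4 * k + 2] vertices. *)
rewrite ltnNge; apply/negP => le_m1.
have n_eq : (4 * k).+2 = 4 * k + 2 by lia.
have := bound_m (directed_cycle (4 * k)) (leq_trans le_m1 (directed_cycle_min_outdeg _)).
rewrite -n_eq => /(_ (directed_cycle_girth _)).
(* The initial arcs of the two paths of [C k k] share their tail. *)
by apply: (@not_contains_subdivision_outdeg1 _ (C k k) (inl (Ordinal hk)) (inr (Ordinal hk)))
  => //; exact: directed_cycle_out.
Qed.
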